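(* Let $k$ be an integer with $2\le k\le N-1$ such that $\phi^{k-1}-\phi^k>\phi^k-\phi^{k+1}$, and suppose there exists a labeled atom ${\tt Z}\in\aleph_k^\bullet$ such that ${\tt N}^{out}_{\tt Z}(F)=\emptyset$ for every $F\in\tilde{\cal F}^{k-1}$. Then $\tilde{\cal F}^{k-1}|_{\uparrow{\tt Z}}=\tilde{\cal F}^{k-1}|_{\tt Z}=\tilde{\cal T}^\bullet_{\tt Z}$; that is, for every $F\in\tilde{\cal F}^{k-1}$, $F|_{\uparrow{\tt Z}}=F|_{\tt Z}\in\tilde{\cal T}^\bullet_{\tt Z}$, and for every $T\in\tilde{\cal T}^\bullet_{\tt Z}$ there exists $Q\in\tilde{\cal F}^{k-1}$ with $Q|_{\uparrow{\tt Z}}=Q|_{\tt Z}=T$.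
   Context: $V$ is a directed graph without loops on a finite vertex set ${\tt N}$, $|{\tt N}|=N$; each arc $(i,j)$ has a real weight $v_{ij}$; $V$ is assumed to have at least one spanning tree. An (entering) forest is a directed graph in which at most one arc leaves each vertex and there are no directed cycles; its components are trees, the root of a tree being its unique vertex with no outgoing arc. All forests and trees are subgraphs of $V$. For a subgraph $G$ and ${\tt D}\subseteq{\tt N}$, $\Upsilon^G_{\tt D}=\sum_{i\in{\tt D},(i,j)\in G}v_{ij}$ (heads may lie outside ${\tt D}$), $\Upsilon^G=\Upsilon^G_{\tt N}$. ${\cal F}^j$: spanning forests of $V$ with exactly $j$ trees; $\phi^j=\min_{F\in{\cal F}^j}\Upsilon^F$ ($\phi^j=\infty$ if ${\cal F}^j=\emptyset$; $\phi^0=\infty$); $\tilde{\cal F}^j$: forests in ${\cal F}^j$ of weight $\phi^j$. $\mathfrak{A}_k$: algebra of subsets of ${\tt N}$ generated by the vertex sets of all trees of all forests in $\tilde{\cal F}^k$; $\aleph_k$: its atoms (nonempty elements ${\tt A}$ with ${\tt A}\cap{\tt B}\in\{\emptyset,{\tt A}\}$ for all ${\tt B}\in\mathfrak{A}_k$); $\aleph_k^\bullet$: labeled atoms (containing a root of some tree of some $F\in\tilde{\cal F}^k$). For ${\tt D}\subseteq{\tt N}$: ${\cal T}^\bullet_{\tt D}$ is the set of trees with vertex set ${\tt D}$, $\lambda^\bullet_{\tt D}=\min_{T\in{\cal T}^\bullet_{\tt D}}\Upsilon^T$, $\tilde{\cal T}^\bullet_{\tt D}=\{T\in{\cal T}^\bullet_{\tt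 D}:\Upsilon^T=\lambda^\bullet_{\tt D}\}$. $G|_{\tt D}$ is the induced subgraph on ${\tt D}$. ${\tt N}^{out}_{\tt D}(G)$ is the set of heads $j\notin{\tt D}$ of arcs $(i,j)\in G$ with $i\in{\tt D}$. The outgoing restriction $G|_{\uparrow{\tt D}}$ has as arcs exactly the arcs of $G$ with tail in ${\tt D}$ and vertex set ${\tt D}\cup{\tt N}^{out}_{\tt D}(G)$. *)

(* Defs.v *)
From mathcomp Require Import all_boot all_order all_algebra.
From mathcomp Require Import reals constructive_ereal.
Set Implicit Arguments.
Unset Strict Implicit.
Unset Printing Implicit Defensive.
Import Order.TTheory GRing.Theory Num.Theory.
Local Open Scope ring_scope.

(* A pair (vertices, arcs); the arc (i, j) goes from i to j.  That the ends of
   the arcs are vertices is required separately, by [is_digraph]. *)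
Definition digraph (T : finType) : Type := ({set T} * {set T * T})%type.

Section Digraphs.
Variable T : finType.
Implicit Types (G H F : digraph T) (D : {set T}) (i j : T).

Definition vertices G : {set T} := G.1.
Definition arcs G : {set T * T} := G.2.

Definition is_digraph G : bool := arcs G \subset setX (vertices G) (vertices G).
Definition loopless G : bool := [forall i, (i, i) \notin arcs G].
Definition subgraph H G : bool :=
  [&& is_digraph H, vertices H \subset vertices G & arcs H \subset arcs G].
Definition spanning_subgraph H G : bool :=
  subgraph H G && (vertices H == vertices G).

Definition arc_rel G : rel T := [rel i j | (i, j) \in arcs G].

Definition acyclic G : bool :=
  [forall i, forall j, ~~ (arc_rel G i j && connect (arc_rel G) j i)].

Lemma acyclicP G :
  reflect (forall c : seq T, c != [::] -> ~~ cycle (arc_rel G) c) (acyclic G).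
Proof.
apply: (iffP idP) => [acG [//|i p] _ | noc].
  apply/negP => /= cyc; case: p cyc => [|j p] /=.
    rewrite andbT => ii.
    by move/forallP/(_ i)/forallP/(_ i)/negP: acG; apply; rewrite ii connect0.
  case/andP => ij pj; move/forallP/(_ i)/forallP/(_ j)/negP: acG; apply.
  rewrite ij /=; apply/connectP; exists (rcons p i) => //.
  by rewrite last_rcons.
apply/forallP => i; apply/forallP => j; apply/negP => /andP[ij].
case/connectP => p pj ei; have /negP := noc (j :: p) isT; apply.
by rewrite /= rcons_path pj -ei.
Qed.

(* Entering forests: the arcs point towards the roots. *)
Definition is_forest G : bool :=
  [forall i in vertices G, #|[set j | (i, j) \in arcs G]| <= 1]%N && acyclic G.

(* The vertex sets of the (weakly) connected components. *)
Definition component_sets G : {set {set T}} :=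
  equivalence_partition
    (connect [rel i j | arc_rel G i j || arc_rel G j i]) (vertices G).

(* Both restrictions are only meant for D \subset vertices G. *)
Definition restr G D : digraph T :=
  (D, [set e in arcs G | (e.1 \in D) && (e.2 \in D)]).

Definition out_heads G D : {set T} :=
  [set j | (j \notin D) && [exists i in D, (i, j) \in arcs G]].

Definition out_restr G D : digraph T :=
  (D :|: out_heads G D, [set e in arcs G | e.1 \in D]).

Definition components G : {set digraph T} :=
  [set restr G D | D in component_sets G].

Definition is_tree G : bool := is_forest G && (#|components G| == 1)%N.

Definition is_root G i : bool :=
  (i \in vertices G) && [forall j, (i, j) \notin arcs G].

End Digraphs.

Section SetAlgebra.
Variable T : finType.
Implicit Types (A B : {set T}) (C S : {set {set T}}).

Definition is_algebra S : bool :=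
  [&& set0 \in S, [forall A in S, ~: A \in S] &
      [forall A in S, forall B in S, A :|: B \in S]].

Definition generated_algebra C : {set {set T}} :=
  \bigcap_(S : {set {set T}} | is_algebra S && (C \subset S)) S.

Definition algebra_atoms S : {set {set T}} :=
  [set A in S | (A != set0) &&
     [forall B in S, (A :&: B == set0) || (A :&: B == A)]].

End SetAlgebra.

Section MinimalForests.
Variables (R : realType) (T : finType).
Variables (V : digraph T) (v : T -> T -> R).
Implicit Types (G F : digraph T) (D : {set T}) (j k : nat).

Definition weight_on G D : R := \sum_(e in arcs G | e.1 \in D) v e.1 e.2.
Definition weight G : R := weight_on G [set: T].

Definition forests j : {set digraph T} :=
  [set F | [&& spanning_subgraph F V, is_forest F & #|components F| == j]].

Definition phi j : \bar R := \big[Order.min/+oo%E]_(F in forests j) (weight F)%:E.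

Definition min_forests j : {set digraph T} :=
  [set F in forests j | (weight F)%:E == phi j].

Definition tree_algebra k : {set {set T}} :=
  generated_algebra [set vertices C | F in min_forests k, C in components F].

Definition atoms k : {set {set T}} := algebra_atoms (tree_algebra k).

Definition labeled_atoms k : {set {set T}} :=
  [set A in atoms k | [exists F in min_forests k, exists C in components F,
     exists i in A, is_root C i]].

Definition trees_on D : {set digraph T} :=
  [set G | [&& subgraph G V, is_tree G & vertices G == D]].

Definition lambda D : \bar R := \big[Order.min/+oo%E]_(G in trees_on D) (weight G)%:E.

Definition min_trees_on D : {set digraph T} :=
  [set G in trees_on D | (weight G)%:E == lambda D].

End MinimalForests.

(* Main.v *)
(* Let F be a minimal forest with k - 1 trees and G one with k trees.  Some tree
   D of G contains no root of F; exchanging the outgoing arcs of F and G on D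
   yields a forest H with k trees and one with k - 1 trees, of the same total
   weight, so H is minimal, and its roots include those of F.  An atom Z lies
   inside one tree of H, hence contains at most one root of F; if no arc of F
   leaves Z, it contains exactly one, and F induces a tree on Z.  That tree can
   be traded in F for any other tree on Z, which gives both its minimality and
   the converse. *)
Require Import Defs.
From mathcomp Require Import all_boot all_order all_algebra.
From mathcomp Require Import reals constructive_ereal.
Set Implicit Arguments.
Unset Strict Implicit.
Unset Printing Implicit Defensive.
Import Order.TTheory GRing.Theory Num.Theory.
Local Open Scope ring_scope.

(** * Roots and trees of an entering forest *)

Section Forests.
Variable T : finType.
Implicit Types (G F : digraph T) (D : {set T}) (x y r i j : T).

Definition roots G : {set T} := [set r | is_root G r].

(** The choice made by [pick] is canonical in a forest, where the reachable root is unique. The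
    default [x] is returned only if no root can be reached, which does not happen for a vertex of a
    forest. *)
Definition root_of G x : T :=
  odflt x [pick r | is_root G r && connect (arc_rel G) x r].

Lemma is_digraphP G : is_digraph G ->
  forall i j, (i, j) \in arcs G -> i \in vertices G /\ j \in vertices G.
Proof. by move=> /subsetP dG i j /dG; rewrite inE => /andP[]. Qed.

Lemma root_no_arc G r j : r \in roots G -> (r, j) \in arcs G = false.
Proof. by rewrite inE => /andP[_ /forallP/(_ j)/negbTE]. Qed.

Lemma roots_vertices G r : r \in roots G -> r \in vertices G.
Proof. by rewrite inE => /andP[]. Qed.

Lemma forest_functional G : is_digraph G -> is_forest G ->
  forall i j j', (i, j) \in arcs G -> (i, j') \in arcs G -> j = j'.
Proof.
move=> dG /andP[/forallP deg _] i j j' ij ij'.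
have [iG _] := is_digraphP dG ij.
have /implyP/(_ iG)/card_le1_eqP := deg i; apply; rewrite inE //.
Qed.

(** Induction on the number of vertices reachable from [x]: following an arc lowers it strictly,
    since by acyclicity [x] itself can no longer be reached. *)
Lemma exists_root G x : is_digraph G -> acyclic G -> x \in vertices G ->
  exists2 r, r \in roots G & connect (arc_rel G) x r.
Proof.
move=> dG /forallP acG.
have [n] := ubnP #|[set y | connect (arc_rel G) x y]|.
elim: n x => // n IHn x; rewrite ltnS => le_n xG.
have [xr | ] := boolP (is_root G x); first by exists x; rewrite ?inE ?connect0.
rewrite /is_root xG /= negb_forall => /existsP[y]; rewrite negbK => xy.
have [_ yG] := is_digraphP dG xy.
have [|//|r rG yr] := IHn y; last first.
  by exists r => //; apply: connect_trans yr; apply: connect1.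
apply: leq_trans le_n; apply/proper_card/properP; split.
  apply/subsetP => z; rewrite !inE; apply: connect_trans; exact: connect1.
exists x; rewrite ?inE ?connect0 //.
by have /forallP/(_ y) := acG x; rewrite negb_and /arc_rel /= xy.
Qed.

(** At most one arc leaves each vertex, so two paths from [x] agree step by step, and neither can
    continue past a root. *)
Lemma unique_root G x r r' : is_digraph G -> is_forest G ->
  r \in roots G -> r' \in roots G ->
  connect (arc_rel G) x r -> connect (arc_rel G) x r' -> r = r'.
Proof.
move=> dG fG rG r'G /connectP[p xp er] /connectP[q xq er'].
elim: p x q xp er xq er' => [|y p IHp] x [|z q] /=; try by move=> *; subst.
- by move=> _ er /andP[xz _]; rewrite -er /arc_rel /= root_no_arc in xz.
- by move=> /andP[xy _] _ _ er'; rewrite -er' /arc_rel /= root_no_arc in xy.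
move=> /andP[xy yp] er /andP[xz zq] er'.
by apply: (IHp y q) => //; rewrite (forest_functional dG fG xy xz).
Qed.

Lemma root_ofP G x : is_digraph G -> is_forest G -> x \in vertices G ->
  root_of G x \in roots G /\ connect (arc_rel G) x (root_of G x).
Proof.
move=> dG /andP[_ acG] xG; rewrite /root_of; case: pickP => [r /andP[rG xr]|no].
  by rewrite inE.
have [r] := exists_root dG acG xG; rewrite inE => rG xr.
by have := no r; rewrite rG xr.
Qed.

Lemma root_of_connect G x y : is_digraph G -> is_forest G -> y \in vertices G ->
  connect (arc_rel G) x y -> root_of G x = root_of G y.
Proof.
move=> dG fG yG xy; have [yr cy] := root_ofP dG fG yG.
have xG : x \in vertices G.
  by case/connectP: xy => -[|z p] /= => [_ <- //|/andP[/(is_digraphP dG)[]]].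
have [xr cx] := root_ofP dG fG xG.
by apply: unique_root cx (connect_trans xy cy).
Qed.

Lemma root_of_arc G i j : is_digraph G -> is_forest G ->
  (i, j) \in arcs G -> root_of G i = root_of G j.
Proof.
move=> dG fG ij; have [_ jG] := is_digraphP dG ij.
by apply: root_of_connect => //; apply: connect1.
Qed.

Lemma root_of_root G r : is_digraph G -> is_forest G -> r \in roots G ->
  root_of G r = r.
Proof.
move=> dG fG rG; have [r'G rr'] := root_ofP dG fG (roots_vertices rG).
by apply: unique_root rr' (connect0 _ _).
Qed.

Definition tree_set G r : {set T} := [set y in vertices G | root_of G y == r].

(** Roots are constant along arcs, hence along undirected paths; conversely, two vertices with the
    same root are weakly connected through it. *)
Lemma component_setsE G : is_digraph G -> is_forest G ->
  component_sets G = tree_set G @: roots G.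
Proof.
move=> dG fG; rewrite /component_sets /equivalence_partition.
set weak := connect _.
have weak_sym : symmetric weak.
  by apply: sym_connect_sym => i j /=; rewrite orbC.
have sub x y : connect (arc_rel G) x y -> weak x y.
  by apply: connect_sub => i j ij; apply: connect1; rewrite /= ij.
have weakE x y : x \in vertices G -> y \in vertices G ->
    weak x y = (root_of G x == root_of G y).
  move=> xG yG; apply/idP/eqP => [/connectP[p]|e].
    elim: p x {xG} => [|z p IHp] x /= => [_ -> //|/andP[xz zp] /(IHp _ zp) <-].
    by case/orP: xz => /(root_of_arc dG fG).
  have [_ /sub cx] := root_ofP dG fG xG; have [_ /sub cy] := root_ofP dG fG yG.
  by apply: connect_trans cx _; rewrite -/weak weak_sym e.
have classE x : x \in vertices G ->
    [set y in vertices G | weak x y] = tree_set G (root_of G x).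
  move=> xG; apply/setP => y; rewrite !inE.
  by case yG: (y \in vertices G); rewrite //= weakE // eq_sym.
apply/setP => D; apply/imsetP/imsetP => [] [x xG ->].
  by exists (root_of G x); [case: (root_ofP dG fG xG)|apply: classE].
exists x; first exact: roots_vertices.
by rewrite classE ?roots_vertices // root_of_root.
Qed.

Lemma card_components G : is_digraph G -> is_forest G ->
  #|components G| = #|roots G|.
Proof.
move=> dG fG; rewrite /components card_imset => [|D D' [] //].
rewrite component_setsE // card_in_imset // => r r' rG r'G /setP/(_ r).
rewrite !inE (roots_vertices rG) /= root_of_root // eqxx.
by move/esym/eqP.
Qed.

(** * Exchange of outgoing arcs between two digraphs *)

(** The vertex set is always full, so that the result is spanning even when [G] is only a tree on
    [D]. *)
Definition graft D G F : digraph T :=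
  ([set: T], [set e in arcs G | e.1 \in D] :|: [set e in arcs F | e.1 \notin D]).

Lemma graftE D G F i j :
  (i, j) \in arcs (graft D G F) =
  if i \in D then (i, j) \in arcs G else (i, j) \in arcs F.
Proof. by rewrite !inE /=; case: ifP; rewrite ?andbT ?andbF ?orbF. Qed.

Lemma graftC D G F : graft (~: D) F G = graft D G F.
Proof.
congr (_, _); apply/setP => -[i j]; rewrite !inE /= negbK.
by rewrite orbC.
Qed.

Definition closed_under G D : Prop :=
  forall i j, (i, j) \in arcs G -> i \in D -> j \in D.

Lemma closed_connect G D x y : closed_under G D -> x \in D ->
  connect (arc_rel G) x y -> y \in D.
Proof.
move=> cD + /connectP[p]; elim: p x => [|z p IHp] x xD /= => [_ -> //|].
by case/andP=> /cD/(_ xD)/IHp.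
Qed.

(** No arc of the graft leaves [D], so a cycle runs entirely inside [D], and is a cycle of [G], or
    entirely outside, and is a cycle of [F]. *)
Lemma acyclic_graft D G F : closed_under G D -> acyclic G -> acyclic F ->
  acyclic (graft D G F).
Proof.
move=> cD /forallP acG /forallP acF; set H := graft D G F.
have cH : closed_under H D.
  by move=> i j; rewrite graftE => + iD; rewrite iD => /cD; apply.
apply/forallP => i; apply/forallP => j; apply/negP => /andP[ij ji].
have [iD | iD] := boolP (i \in D).
  have jD := cH _ _ ij iD.
  have /forallP/(_ j)/negP := acG i; apply.
  move: ij; rewrite /arc_rel /= graftE iD => -> /=.
  case/connectP: ji => p; elim: p j jD => [|z p IHp] x xD /=.
    by move=> _ ->; apply: connect0.
  rewrite -[X in X && _]/((x, z) \in arcs H) graftE xD => /andP[xz zp] ei.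
  by apply: connect_trans (connect1 xz) (IHp _ (cD _ _ xz xD) zp ei).
have /forallP/(_ j)/negP := acF i; apply.
move: ij; rewrite /arc_rel /= graftE (negbTE iD) => -> /=.
case/connectP: ji => p; elim: p j => [|z p IHp] x /=.
  by move=> _ ->; apply: connect0.
(* A path that has entered [D] stays there, whereas this one ends at [i], outside [D]. *)
move=> xp ei; have xD : x \notin D.
  apply: contra iD => xD; apply: (closed_connect cH xD).
  by apply/connectP; exists (z :: p).
move: xp; rewrite -[X in X && _]/((x, z) \in arcs H) graftE (negbTE xD) => /andP[xz zp].
by apply: connect_trans (connect1 xz) (IHp _ zp ei).
Qed.

Lemma forest_graft D G F : is_digraph G -> is_digraph F ->
  is_forest G -> is_forest F -> closed_under G D -> is_forest (graft D G F).
Proof.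
move=> dG dF fG fF cD; apply/andP; split; last first.
  by case/andP: fG => _ ?; case/andP: fF => _ ?; apply: acyclic_graft.
apply/forallP => i; apply/implyP => _; apply/card_le1_eqP => j j'.
rewrite [j \in _]inE [j' \in _]inE !graftE.
case: ifP => _ ij ij'; first exact: (forest_functional dG fG ij' ij).
exact: (forest_functional dF fF ij' ij).
Qed.

Lemma roots_graft D G F : D \subset vertices G -> ~: D \subset vertices F ->
  roots (graft D G F) = (roots G :&: D) :|: (roots F :\: D).
Proof.
move=> /subsetP DG /subsetP DF; apply/setP => i.
rewrite inE /is_root in_setT /=.
under eq_forallb => j do rewrite graftE.
rewrite !inE /is_root; have [iD|iD] := boolP (i \in D).
  by rewrite DG // andbT orbF.
by rewrite DF ?inE //= andbF.
Qed.

End Forests.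

(** Since [x] lies in [A], the default [+oo] never is the minimum, and minimality becomes a
    comparison of reals. *)
Lemma eq_bigminE (R : realType) (I : finType) (A : {set I}) (f : I -> R) x :
  x \in A ->
  ((f x)%:E == \big[Order.min/+oo%E]_(y in A) (f y)%:E) =
  [forall y in A, f x <= f y].
Proof.
move=> xA; rewrite eq_le bigmin_le_cond // andbT.
apply/bigmin_geP/forall_inP => [[_ le_f] y yA | le_f].
  by rewrite -lee_fin; apply: le_f.
by split=> [|y yA]; rewrite ?leey // lee_fin le_f.
Qed.

(** * Weights and minimality of forests and trees *)

Section MinimalForests.
Variables (R : realType) (T : finType) (V : digraph T) (v : T -> T -> R).
Hypothesis V_vertices : vertices V = [set: T].
Implicit Types (F G H : digraph T) (D Z : {set T}) (j k : nat).

Lemma weight_onID F D : weight v F = weight_on v F D + weight_on v F (~: D).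
Proof.
rewrite /weight /weight_on (bigID [pred e | e.1 \in D]) /=; congr (_ + _).
  by apply: eq_bigl => e; rewrite inE andbT.
by apply: eq_bigl => e; rewrite !inE andbT.
Qed.

Lemma weight_graft D G F :
  weight v (graft D G F) = weight_on v G D + weight_on v F (~: D).
Proof.
rewrite (weight_onID _ D); congr (_ + _); apply: eq_bigl => -[i j];
  rewrite graftE /= ?inE; by case: (i \in D); rewrite ?andbF.
Qed.

(** The two grafts together use each outgoing arc of [F] and of [G] once. *)
Lemma weight_exchange D G F :
  weight v (graft D G F) + weight v (graft D F G) = weight v F + weight v G.
Proof.
rewrite !weight_graft (weight_onID F D) (weight_onID G D).
by rewrite addrC addrACA [RHS]addrACA; congr (_ + _); rewrite addrC.
Qed.

Lemma spanning_digraph F : vertices F = [set: T] -> is_digraph F.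
Proof. by move=> vF; apply/subsetP => e _; rewrite inE vF !inE. Qed.

(** Trees are counted by their roots, which [roots_graft] makes computable for a graft. *)
Lemma forestsP j F :
  reflect [/\ vertices F = [set: T], arcs F \subset arcs V, is_forest F
            & #|roots F| = j]
          (F \in forests V j).
Proof.
rewrite inE /spanning_subgraph /subgraph V_vertices subsetT /=.
apply: (iffP and3P) => [[/andP[/andP[dF sF] /eqP vF] fF /eqP <-] | [vF sF fF <-]].
  by rewrite card_components.
have dF := spanning_digraph vF.
by rewrite dF sF vF eqxx card_components.
Qed.

Lemma min_forestsP j F :
  reflect (F \in forests V j /\
           forall G, G \in forests V j -> weight v F <= weight v G)
          (F \in min_forests V v j).
Proof.
apply: (iffP setIdP) => -[Fj]; first by rewrite eq_bigminE // => /forall_inP.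
by move=> minF; rewrite eq_bigminE //; split=> //; apply/forall_inP.
Qed.

Lemma trees_onP D G :
  reflect [/\ is_digraph G, vertices G = D, arcs G \subset arcs V, is_forest G
            & #|roots G| = 1%N]
          (G \in trees_on V D).
Proof.
rewrite inE /subgraph /is_tree V_vertices subsetT /=.
apply: (iffP and3P) => [[/andP[dG sG] /andP[fG] + /eqP vG] | [dG vG sG fG rG]].
  by rewrite card_components // => /eqP.
by rewrite dG sG fG vG eqxx card_components // rG.
Qed.

Lemma min_trees_onP D G :
  reflect (G \in trees_on V D /\
           forall H, H \in trees_on V D -> weight v G <= weight v H)
          (G \in min_trees_on V v D).
Proof.
apply: (iffP setIdP) => -[GD]; first by rewrite eq_bigminE // => /forall_inP.
by move=> minG; rewrite eq_bigminE //; split=> //; apply/forall_inP.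
Qed.

(** Closedness of either side excludes cycles crossing the boundary of [D]; [graftC] swaps the two
    sides, reducing the second case to the first. *)
Lemma graft_forests D G F a b : F \in forests V b ->
  is_digraph G -> is_forest G -> arcs G \subset arcs V ->
  D \subset vertices G ->
  closed_under G D \/ closed_under F (~: D) ->
  #|(roots G :&: D) :|: (roots F :\: D)| = a ->
  graft D G F \in forests V a.
Proof.
move=> /forestsP[vF sF fF _] dG fG sG DG cD ra.
have dF := spanning_digraph vF.
apply/forestsP; split=> //.
- apply/subsetP => -[i j]; rewrite graftE.
  by case: ifP => _ ?; [apply: (subsetP sG)|apply: (subsetP sF)].
- case: cD => cD; first exact: forest_graft.
  by rewrite -graftC; apply: forest_graft.
by rewrite roots_graft // vF subsetT.
Qed.

(** * The exchange argument, atoms, and existence of forests *)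

(** [H'] weighs at least as much as [F], so [H] weighs at most as much as [G]. *)
Lemma min_forests_min_of_sum a b F G H H' :
  F \in min_forests V v a -> G \in min_forests V v b ->
  H \in forests V b -> H' \in forests V a ->
  weight v H + weight v H' = weight v F + weight v G ->
  H \in min_forests V v b.
Proof.
move=> /min_forestsP[_ minF] /min_forestsP[_ minG] Hb H'a e.
apply/min_forestsP; split=> // K /minG; apply: le_trans.
by rewrite -(lerD2r (weight v H')) e addrC lerD2l minF.
Qed.

Lemma min_forests_add_root k F G :
  F \in min_forests V v k -> G \in min_forests V v k.+1 ->
  exists2 H, H \in min_forests V v k.+1 & roots F \subset roots H.
Proof.
move=> Fk Gk; have [Ff _] := min_forestsP _ _ Fk.
have [Gf _] := min_forestsP _ _ Gk.
have [vF sF fF rF] := forestsP _ _ Ff; have [vG sG fG rG] := forestsP _ _ Gf.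
have dF := spanning_digraph vF; have dG := spanning_digraph vG.
(* Pigeonhole: [G] has one root more than [F], so some tree of [G] contains no root of [F]. *)
have [r rGr r_no] : exists2 r, r \in roots G & r \notin root_of G @: roots F.
  apply/subsetPn; apply: contraTN (leqnn k) => /subset_leq_card.
  by rewrite rG -ltnNge => /leq_trans; apply; rewrite -rF leq_imset_card.
pose D := tree_set G r.
have DE x : (x \in D) = (root_of G x == r) by rewrite inE vG inE.
(* No arc of [G] crosses the boundary of [D] in either direction: closedness of [D] makes one graft
   a forest, closedness of its complement the other. *)
have arcD (i j : T) : (i, j) \in arcs G -> (i \in D) = (j \in D).
  by move=> ij; rewrite !DE (root_of_arc dG fG ij).
have FD : roots F :&: D = set0.
  apply/setP => x; rewrite in_setI in_set0 DE; apply/negP => /andP[xF /eqP xr].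
  by case/negP: r_no; rewrite -xr imset_f.
have GD : roots G :&: D = [set r].
  apply/setP => x; rewrite in_setI in_set1 DE.
  have [xG|xG] := boolP (x \in roots G); first by rewrite root_of_root.
  by apply/esym; apply: contraNF xG => /eqP ->.
have FDd : roots F :\: D = roots F.
  by apply/setDidPl; rewrite -setI_eq0 FD.
have rFr : r \notin roots F.
  apply/negP => rFr; have : r \in roots F :&: D by rewrite inE rFr DE root_of_root /=.
  by rewrite FD inE.
exists (graft D G F); last first.
  by rewrite roots_graft ?vG ?vF ?subsetT // FDd subsetUr.
apply: (min_forests_min_of_sum Fk Gk (H' := graft D F G)).
- apply: (graft_forests Ff dG fG sG _ _ _); rewrite ?vG ?subsetT //.
    by left => i j /arcD <-.
  (* The roots are those of [F] together with [r]. *)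
  by rewrite GD FDd cardsU1 rFr rF.
- apply: (graft_forests Gf dF fF sF _ _ _); rewrite ?vF ?subsetT //.
    by right => i j /arcD; rewrite !inE => <-.
  (* The roots are those of [G] except [r], since [F] has none in [D]. *)
  rewrite FD set0U; apply/eqP.
  by rewrite -(eqn_add2l #|roots G :&: D|) cardsID rG GD cards1.
exact: weight_exchange.
Qed.

(** The tree of [H] through [x] belongs to the algebra and meets the atom [Z] in [x], so it contains
    all of [Z]. *)
Lemma atoms_separate k Z H x y : Z \in atoms V v k ->
  H \in min_forests V v k -> x \in Z -> y \in Z -> root_of H x = root_of H y.
Proof.
rewrite inE => /and3P[_ _ /forall_inP atom] Hk xZ yZ.
have [/forestsP[vH _ fH _] _] := min_forestsP _ _ Hk.
have dH := spanning_digraph vH.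
have [|rx _] := root_ofP (x := x) dH fH; first by rewrite vH.
have : tree_set H (root_of H x) \in tree_algebra V v k.
  apply/bigcapP => S /andP[_ /subsetP]; apply; apply/imset2P.
  exists H (restr H (tree_set H (root_of H x))) => //.
  by rewrite !imset_f // component_setsE // imset_f.
move/atom => /orP[/eqP/setP/(_ x)|/eqP/setP/(_ y)]; rewrite !inE vH !inE.
  by rewrite xZ eqxx.
by rewrite yZ /= => /eqP.
Qed.

(** Starting from a spanning tree, deleting the outgoing arc of a vertex that is not a root adds
    exactly one tree. *)
Lemma forests_nonempty j :
  (exists G, spanning_subgraph G V /\ is_tree G) -> (0 < j <= #|T|)%N ->
  exists F, F \in forests V j.
Proof.
move=> [G [sG /andP[fG cG]]]; case: j => //; elim=> [_|j IHj /= lej].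
  by exists G; rewrite inE sG fG.
have [|F Ff] := IHj; first exact: ltnW.
have [vF sF fF rF] := forestsP _ _ Ff.
have [i _ iF] : exists2 i, i \in [set: T] & i \notin roots F.
  by apply/subsetPn; apply: contraTN lej => /subset_leq_card; rewrite rF cardsT -ltnNge.
(* Grafting this arcless digraph on [[set i]] deletes the arc leaving [i]. *)
pose E : digraph T := ([set: T], set0).
have dE : is_digraph E by apply: spanning_digraph.
have noE x y : (x, y) \in arcs E = false by rewrite inE.
have fE : is_forest E.
  apply/andP; split; apply/forallP => x.
    by apply/implyP => _; apply/card_le1_eqP => y z; rewrite !inE.
  by apply/forallP => y; rewrite /arc_rel /= noE.
have rE : roots E = [set: T].
  apply/setP => x; rewrite inE [RHS]in_setT; apply/andP; split; first exact: in_setT.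
  by apply/forallP => y; rewrite noE.
exists (graft [set i] E F).
apply: (graft_forests Ff dE fE _ _ _ _); rewrite ?subsetT ?sub0set //.
  by left => x y; rewrite noE.
rewrite rE setTI cardsU1 in_setD1 eqxx -rF (cardsD1 i (roots F)).
by rewrite (negbTE iF).
Qed.

(** * Restriction to a closed set and replacement of the tree on it *)

Lemma closed_underP F Z : out_heads F Z = set0 <-> closed_under F Z.
Proof.
split=> [/setP out0 i j ij iZ | cZ].
  apply/negPn/negP => jZ; have := out0 j; rewrite !inE jZ => /existsP[].
  by exists i; rewrite iZ.
apply/setP => j; rewrite !inE; apply/andP => -[/negP jZ /exists_inP[i iZ ij]].
exact/jZ/(cZ i).
Qed.

Lemma out_restr_closed F Z : closed_under F Z -> out_restr F Z = restr F Z.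
Proof.
move=> cZ; rewrite /out_restr /restr; have /closed_underP -> := cZ.
rewrite setU0; congr (_, _); apply/setP => -[i j]; rewrite !inE /=.
case: (boolP (_ \in arcs F)) => //= ij.
by case: (boolP (i \in Z)) => //= /(cZ _ _ ij) ->.
Qed.

Lemma restr_arc F Z (i j : T) : closed_under F Z ->
  (i, j) \in arcs (restr F Z) = ((i, j) \in arcs F) && (i \in Z).
Proof. by move=> cZ; rewrite -out_restr_closed // inE. Qed.

(** A vertex of the closed set [Z] keeps all its outgoing arcs, so the roots of the restriction are
    the roots of [F] in [Z]. *)
Lemma restr_tree F Z j : F \in forests V j -> closed_under F Z ->
  #|roots F :&: Z| = 1%N -> restr F Z \in trees_on V Z.
Proof.
move=> /forestsP[vF sF fF _] cZ r1; have dF := spanning_digraph vF.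
have sub : arcs (restr F Z) \subset arcs F.
  by apply/subsetP => e; rewrite inE => /andP[].
apply/trees_onP; split=> //.
- by apply/subsetP => e; rewrite inE => /andP[_]; rewrite inE.
- exact: subset_trans sub sF.
- apply/andP; split.
    apply/forallP => i; apply/implyP => _; apply/card_le1_eqP => x y.
    rewrite [x \in _]inE [y \in _]inE => /(subsetP sub) ix /(subsetP sub) iy.
    exact: forest_functional iy ix.
  have /andP[_ /forallP acF] := fF; apply/forallP => x; apply/forallP => y.
  have /forallP/(_ y) := acF x; apply: contra => /andP[/(subsetP sub) xy yx].
  rewrite /arc_rel /= xy; apply: connect_sub yx => a b ab; apply: connect1.
  exact: (subsetP sub).
rewrite -r1; apply: eq_card => i; rewrite !inE /is_root vF inE /= andbC.
have [iZ|] := boolP (i \in Z); last by rewrite !andbF.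
by rewrite !andbT; apply: eq_forallb => x; rewrite restr_arc // iZ andbT.
Qed.

Lemma weight_restr F Z : closed_under F Z ->
  weight v (restr F Z) = weight_on v F Z.
Proof.
by move=> cZ; apply: eq_bigl => -[i j]; rewrite restr_arc // inE andbT.
Qed.

Lemma restr_graft F G Z : is_digraph G -> vertices G = Z ->
  restr (graft Z G F) Z = G.
Proof.
case: G => W A dG /= vG; rewrite -{Z}vG; congr (_, _).
apply/setP => -[i j]; rewrite inE graftE /=.
have [|nij] := boolP ((i, j) \in A).
  by move/(is_digraphP dG) => [/= -> ->]; rewrite andbT.
by case: (i \in W); rewrite ?andbF //= (negbTE nij).
Qed.

Lemma closed_graft F G Z : is_digraph G -> vertices G = Z ->
  closed_under (graft Z G F) Z.
Proof.
move=> dG vG i j; rewrite graftE => + iZ; rewrite iZ => /(is_digraphP dG)[].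
by rewrite vG.
Qed.

(** The arcs of [G] stay in [Z], so no cycle arises, and the single root of [F] in [Z] is replaced
    by the single root of [G]. *)
Lemma graft_tree F G Z j : F \in forests V j -> #|roots F :&: Z| = 1%N ->
  G \in trees_on V Z -> graft Z G F \in forests V j.
Proof.
move=> Ff r1 /trees_onP[dG vG sG fG rG].
have [_ _ _ rF] := forestsP _ _ Ff.
apply: (graft_forests Ff dG fG sG _ _ _); rewrite ?vG //.
  by left => a b /(is_digraphP dG)[]; rewrite vG.
have -> : roots G :&: Z = roots G.
  by apply/setIidPl/subsetP => x /roots_vertices; rewrite vG.
rewrite cardsU rG -{}rF -(cardsID Z (roots F)) r1.
rewrite (_ : _ :&: _ = set0) ?cards0 ?subn0 //; apply/setP => x.
rewrite !in_setI in_set0 in_setD; apply/and3P => -[/roots_vertices].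
by rewrite vG => ->.
Qed.

(** Written with sums on both sides, so that comparing the graft with [F] becomes, by cancellation,
    comparing [G] with [restr F Z]. *)
Lemma weight_graft_tree F G Z : is_digraph G -> vertices G = Z ->
  closed_under F Z ->
  weight v (graft Z G F) + weight v (restr F Z) = weight v G + weight v F.
Proof.
move=> dG vG cZ; rewrite weight_graft weight_restr // [weight v F](weight_onID _ Z).
suff -> : weight_on v G Z = weight v G by rewrite -addrA [in LHS](addrC (weight_on v F _)).
apply: eq_bigl => -[i j]; rewrite inE andbT.
by case: (boolP (_ \in _)) => //= /(is_digraphP dG)[]; rewrite vG => ->.
Qed.

(* A root of F in Z exists since Z is closed; it is unique since F shares its
   roots with a minimal forest of which Z meets only one tree. *)
Lemma closed_atom_one_root k F G Z : Z \in atoms V v k.+1 ->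
  F \in min_forests V v k -> G \in min_forests V v k.+1 ->
  closed_under F Z -> #|roots F :&: Z| = 1%N.
Proof.
move=> Zk Fk Gk cZ; have [/forestsP[vF _ fF _] _] := min_forestsP _ _ Fk.
have dF := spanning_digraph vF.
apply/eqP; rewrite eqn_leq; apply/andP; split.
  have [H Hk /subsetP FH] := min_forests_add_root Fk Gk.
  have [/forestsP[vH _ fH _] _] := min_forestsP _ _ Hk.
  have dH := spanning_digraph vH.
  apply/card_le1_eqP => x y /setIP[xF xZ] /setIP[yF yZ].
  rewrite -(root_of_root dH fH (FH _ xF)) -(root_of_root dH fH (FH _ yF)).
  exact: atoms_separate Zk Hk _ _.
have /set0Pn[z zZ] : Z != set0 by move: Zk; rewrite inE => /and3P[].
have [|rz cz] := root_ofP (x := z) dF fF; first by rewrite vF.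
apply/card_gt0P; exists (root_of F z); rewrite inE rz.
exact: closed_connect cZ zZ cz.
Qed.

End MinimalForests.

(** * Minimal trees on the closed atom *)

Theorem theorem6 (R : realType) (T : finType) (V : digraph T) (v : T -> T -> R)
    (V_vertices : vertices V = [set: T])
    (V_digraph : is_digraph V)
    (V_loopless : loopless V)
    (V_spanning_tree : exists G : digraph T, spanning_subgraph G V /\ is_tree G)
    (k : nat) (k_range : (2 <= k <= #|T| - 1)%N)
    (phi_gap : (phi V v k - phi V v k.+1 < phi V v k.-1 - phi V v k)%E)
    (Z : {set T}) (Z_labeled : Z \in labeled_atoms V v k)
    (Z_closed : forall F : digraph T,
        F \in min_forests V v k.-1 -> out_heads F Z = set0) :
  ([set out_restr F Z | F in min_forests V v k.-1]
     = [set restr F Z | F in min_forests V v k.-1]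
   /\ [set restr F Z | F in min_forests V v k.-1] = min_trees_on V v Z)
  /\ (forall F : digraph T, F \in min_forests V v k.-1 ->
        out_restr F Z = restr F Z /\ restr F Z \in min_trees_on V v Z)
  /\ (forall G : digraph T, G \in min_trees_on V v Z ->
        exists2 Q : digraph T, Q \in min_forests V v k.-1 &
          out_restr Q Z = restr Q Z /\ restr Q Z = G).
Proof.
(* From here on [k] stands for the $k-1$ of the statement. The label of [Z] then supplies a minimal
   forest [G] with [k.+1] trees. *)
case: k k_range phi_gap Z_labeled Z_closed => // k /andP[k_gt1 k_le] _ + Z_closed.
rewrite inE => /andP[Z_atom /exists_inP[G Gk _]] /=.
have clZ F : F \in min_forests V v k -> closed_under F Z.
  by move=> Fk; apply/closed_underP/Z_closed.
have oneZ F : F \in min_forests V v k -> #|roots F :&: Z| = 1%N.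
  move=> Fk; exact: (closed_atom_one_root V_vertices Z_atom Fk Gk (clZ F Fk)).
have direct F : F \in min_forests V v k ->
    out_restr F Z = restr F Z /\ restr F Z \in min_trees_on V v Z.
  move=> Fk; have [Ff minF] := min_forestsP _ _ _ _ Fk.
  split; first exact/out_restr_closed/clZ.
  apply/min_trees_onP => //; split=> [|H HZ].
    exact: restr_tree Ff (clZ _ Fk) (oneZ _ Fk).
  have [dH vH _ _ _] := trees_onP V_vertices _ _ HZ.
  (* Replacing [restr F Z] by [H] in [F] cannot lower the weight, hence [H] is no lighter than
     [restr F Z]. *)
  have := minF _ (graft_tree V_vertices Ff (oneZ _ Fk) HZ).
  rewrite -(lerD2r (weight v (restr F Z))) (weight_graft_tree _ dH vH (clZ _ Fk)).
  by rewrite addrC lerD2r.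
have converse H : H \in min_trees_on V v Z ->
    exists2 Q, Q \in min_forests V v k & out_restr Q Z = restr Q Z /\ restr Q Z = H.
  case/min_trees_onP=> // HZ minH.
  have [F Fk] : exists F, F \in min_forests V v k.
    have [|F0 F0f] := @forests_nonempty _ _ V_vertices k V_spanning_tree.
      rewrite -ltnS k_gt1 ltnW //; apply: leq_trans k_le (leq_subr _ _).
    case: (arg_minP (weight v) F0f) => F Ff minF; exists F.
    exact/min_forestsP.
  have [Ff minF] := min_forestsP _ _ _ _ Fk.
  have [dH vH _ _ _] := trees_onP V_vertices _ _ HZ.
  (* The witness is any minimal [F] with its tree on [Z] replaced by [H]. *)
  exists (graft Z H F); last first.
    by rewrite out_restr_closed ?restr_graft //; apply: closed_graft.
  apply/min_forestsP=> //; split.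
    exact: (graft_tree V_vertices Ff (oneZ _ Fk) HZ).
  move=> K /minF; apply: le_trans.
  (* The graft is no heavier than [F] because [H] is no heavier than [restr F Z], which by [direct]
     is itself a tree on [Z]. *)
  rewrite -(lerD2r (weight v (restr F Z))) (weight_graft_tree _ dH vH (clZ _ Fk)).
  rewrite addrC lerD2l; apply: minH.
  by have [_ /min_trees_onP[]] := direct F Fk.
split; last by [].
split; first by apply: eq_in_imset => F /direct[].
apply/setP => H; apply/imsetP/idP => [[F /direct[_ ?] -> //]|/converse[Q Qk [_ <-]]].
by exists Q.
Qed.
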